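(* Let $m$ and $n$ be integers such that $m$ is odd, $n$ is even, $0.5 \leq n/m \leq 0.8194$ and $m \geq 81$. Then the function $$f(x) = \frac{n\sin x-\sin(nx)}{m\sin x-\sin(mx)}$$ satisfies $$\min_{x\in\mathbb{R}} f(x) = f(0)=\frac{n^3-n}{m^3-m}.$$ In particular, Bombieri's conjectured equality $\sigma_{mn}=B_{mn}$ fails for all these pairs of integers $(m,n)$, i.e. $\sigma_{mn}\neq B_{mn}$.
   Context: The function $f$ is $2\pi$-periodic; its denominator vanishes only at integer multiples of $\pi$. At even multiples of $\pi$, $f$ is defined by its limit, so $f(0)=\frac{n^3-n}{m^3-m}$; at odd multiples of $\pi$ (for $m$ odd, $n$ even) its limit is $+\infty$, and $f$ is given the value $+\infty$ there. Let $S$ denote the class of analytic univalent (injective) functions on the unit disk $\{|z|<1\}$ of the form $F(z)=z+a_2z^2+a_3z^3+\dots$, and let $K(z)=z/(1-z)^2$ be the Koebe function. For integers $m,n\ge 2$ define $$\sigma_{mn}=\liminf_{F\to K}\frac{n-\mathrm{Re}\,a_n}{m-\mathrm{Re}\,a_m},\qquad B_{mn}=\min_{x\in\mathbb{R}}\frac{n\sin x-\sin(nx)}{m\sin x-\sin(mx)},$$ where $a_k$ denotes the $k$-th Taylor coefficient of $F$ at $0$, and the limit is taken over $F\in S$, $F\ne K$, in the sense of uniform convergence on compact subsets of the unit disk. Bombieri's conjecture asserts that $\sigma_{mn}=B_{mn}$. *)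

(* Defs.v *)
From Stdlib Require Import Reals Arith List.
From Coquelicot Require Import Coquelicot.

Open Scope R_scope.

Definition sine_num (n : nat) (x : R) : R := INR n * sin x - sin (INR n * x).

Definition sine_quot (m n : nat) (x : R) : R := sine_num n x / sine_num m x.

(* At the zeros of the denominator the quotient is extended by its limit,
   which may be [p_infty]. *)
Definition bombieri_f (m n : nat) (x : R) : Rbar :=
  if Req_EM_T (sine_num m x) 0
  then Lim (sine_quot m n) x
  else Finite (sine_quot m n x).

Definition is_min_at (g : R -> Rbar) (x0 : R) : Prop :=
  forall x : R, Rbar_le (g x0) (g x).

(* The greatest lower bound of the range; it is the minimum as soon as it is
   attained. *)
Definition bombieri_B (m n : nat) : Rbar :=
  Rbar_glb (fun v => exists x : R, v = bombieri_f m n x).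

Definition in_disk (z : C) : Prop := Cmod z < 1.

(* Functions on the disk are represented by functions [C -> C], whose values
   outside the disk are irrelevant. *)
Definition holomorphic_disk (F : C -> C) : Prop :=
  forall z : C, in_disk z -> @ex_derive C_AbsRing C_NormedModule F z.

Definition univalent_disk (F : C -> C) : Prop :=
  forall z w : C, in_disk z -> in_disk w -> F z = F w -> z = w.

Definition taylor_coeffs (F : C -> C) (a : nat -> C) : Prop :=
  forall z : C, in_disk z -> @is_pseries C_AbsRing C_NormedModule a z (F z).

Definition class_S (F : C -> C) : Prop :=
  holomorphic_disk F /\ univalent_disk F /\
  exists a : nat -> C,
    taylor_coeffs F a /\ a 0%nat = RtoC 0 /\ a 1%nat = RtoC 1.

Definition koebe (z : C) : C := (z / ((1 - z) * (1 - z)))%C.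

Definition compact_set (A : C -> Prop) : Prop :=
  forall (I : Type) (U : I -> C -> Prop),
    (forall i : I, @open C_UniformSpace (U i)) ->
    (forall z : C, A z -> exists i : I, U i z) ->
    exists l : list I, forall z : C, A z -> exists i : I, In i l /\ U i z.

(* The values of the coefficient quotient on the punctured neighbourhood of the
   Koebe function given by [A] and [eps].  The Taylor coefficients [a] are
   determined by [F]. *)
Definition coeff_quot_near (m n : nat) (A : C -> Prop) (eps : R) (q : Rbar)
  : Prop :=
  exists (F : C -> C) (a : nat -> C),
    class_S F /\ taylor_coeffs F a /\
    ~ (forall z : C, in_disk z -> F z = koebe z) /\
    (forall z : C, A z -> Cmod (F z - koebe z) < eps) /\
    q = Finite ((INR n - Re (a n)) / (INR m - Re (a m))).

(* The lower limit as the supremum, over the basic neighbourhoods of the Koebe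
   function for uniform convergence on compact subsets of the disk, of the
   infima over these neighbourhoods.  Near the Koebe function the denominator
   vanishes at no other member of the class, because |a_m| <= m with equality
   only for rotations of the Koebe function. *)
Definition bombieri_sigma (m n : nat) : Rbar :=
  Rbar_lub (fun l => exists (A : C -> Prop) (eps : R),
    compact_set A /\ (forall z : C, A z -> in_disk z) /\ 0 < eps /\
    l = Rbar_glb (coeff_quot_near m n A eps)).

(* Main.v *)
(** Write [a = n/m] and [c = f(0)].  As [f] is a function of [cos x], it suffices
    to compare [n sin x - sin (nx)] with [c (m sin x - sin (mx))] on [(0, PI)].
    - For [mx <= 5.77] the quotient [(k sin x - sin (kx)) / (k^3 - k)]
      decreases in the real variable [k].
    - Near [PI], put [y = PI - x] and [t = my].  By the parities of [m] and
      [n], what has to be nonnegative is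
      [(n - c m) sin y + sin (ny) + c sin (my)], which is close to
      [a (1 - a^2) t + sin (at) + a^3 sin t].  The critical case is
      [a = 0.8194], [t ~ 5.0444], where the margin is about [10^-4].  Where
      both sines are negative they are convex, and replacing them by their
      tangents at these critical arguments gives a bound which is decreasing
      in [a] and almost independent of [at].
    - In between, [(n - c m) sin x >= 1 + c].
    The conjecture then fails because of the rotations [z / (1 - wz)^2],
    [w = exp (it)], of the Koebe function: the coefficient quotient is
    [n (1 - cos ((n-1)t)) / (m (1 - cos ((m-1)t)))], which tends to
    [n (n-1)^2 / (m (m-1)^2) < (n^3 - n) / (m^3 - m)] as [t -> 0]. *)

Require Import Defs.
From Stdlib Require Import Reals Arith Lra Lia Psatz List.
From Coquelicot Require Import Coquelicot.
Open Scope R_scope.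

(** * Taylor bounds for sine and cosine on the half-line *)

(** Each Taylor bound below follows from the previous one, which gives the sign of the derivative of
    the difference of its two sides. *)
Lemma nonneg_of_deriv_nonneg (f f' : R -> R) :
  f 0 = 0 -> (forall t, 0 <= t -> is_derive f t (f' t)) ->
  (forall t, 0 <= t -> 0 <= f' t) -> forall t, 0 <= t -> 0 <= f t.
Proof.
intros f0 Hd Hp t [ht | <-]; [ | lra].
destruct (MVT_cor2 f f' 0 t ht) as [c [Hc Hct]].
  intros c Hc; apply is_derive_Reals, Hd; lra.
assert (0 <= f' c) by (apply Hp; lra); nra.
Qed.

Lemma sin_le_id (t : R) : 0 <= t -> sin t <= t.
Proof.
intros ht; apply Rminus_le_0.
apply (nonneg_of_deriv_nonneg (fun t => t - sin t) (fun t => 1 - cos t)); trivial.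
- rewrite sin_0; lra.
- intros u _; auto_derive; trivial; ring.
- intros u _; pose proof (COS_bound u); lra.
Qed.

Lemma cos_ge_taylor2 (t : R) : 0 <= t -> 1 - t ^ 2 / 2 <= cos t.
Proof.
intros ht; apply Rminus_le_0.
apply (nonneg_of_deriv_nonneg (fun t => cos t - (1 - t ^ 2 / 2))
  (fun t => t - sin t)); trivial.
- rewrite cos_0; lra.
- intros u _; auto_derive; trivial; field.
- intros u hu; pose proof (sin_le_id u hu); lra.
Qed.

Lemma sin_ge_taylor3 (t : R) : 0 <= t -> t - t ^ 3 / 6 <= sin t.
Proof.
intros ht; apply Rminus_le_0.
apply (nonneg_of_deriv_nonneg (fun t => sin t - (t - t ^ 3 / 6))
  (fun t => cos t - (1 - t ^ 2 / 2))); trivial.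
- rewrite sin_0; lra.
- intros u _; auto_derive; trivial; field.
- intros u hu; pose proof (cos_ge_taylor2 u hu); lra.
Qed.

Lemma cos_le_taylor4 (t : R) : 0 <= t -> cos t <= 1 - t ^ 2 / 2 + t ^ 4 / 24.
Proof.
intros ht; apply Rminus_le_0.
apply (nonneg_of_deriv_nonneg (fun t => 1 - t ^ 2 / 2 + t ^ 4 / 24 - cos t)
  (fun t => sin t - (t - t ^ 3 / 6))); trivial.
- rewrite cos_0; lra.
- intros u _; auto_derive; trivial; field.
- intros u hu; pose proof (sin_ge_taylor3 u hu); lra.
Qed.

Lemma sin_le_taylor5 (t : R) :
  0 <= t -> sin t <= t - t ^ 3 / 6 + t ^ 5 / 120.
Proof.
intros ht; apply Rminus_le_0.
apply (nonneg_of_deriv_nonneg (fun t => t - t ^ 3 / 6 + t ^ 5 / 120 - sin t)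
  (fun t => 1 - t ^ 2 / 2 + t ^ 4 / 24 - cos t)); trivial.
- rewrite sin_0; lra.
- intros u _; auto_derive; trivial; field.
- intros u hu; pose proof (cos_le_taylor4 u hu); lra.
Qed.

Lemma cos_ge_taylor6 (t : R) :
  0 <= t -> 1 - t ^ 2 / 2 + t ^ 4 / 24 - t ^ 6 / 720 <= cos t.
Proof.
intros ht; apply Rminus_le_0.
apply (nonneg_of_deriv_nonneg
  (fun t => cos t - (1 - t ^ 2 / 2 + t ^ 4 / 24 - t ^ 6 / 720))
  (fun t => t - t ^ 3 / 6 + t ^ 5 / 120 - sin t)); trivial.
- rewrite cos_0; lra.
- intros u _; auto_derive; trivial; field.
- intros u hu; pose proof (sin_le_taylor5 u hu); lra.
Qed.

(** * Bounds on PI and monotonicity of the sine quotient in its real index *)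

Lemma PI_gt_3 : 3 < PI.
Proof. pose proof PI2_3_2; lra. Qed.

Lemma PI_lt_34_10 : PI < 3.4.
Proof.
destruct (Rlt_or_le PI 3.4) as [h | h]; trivial; exfalso.
assert (0 <= cos 1.7) by (apply cos_ge_0; lra).
pose proof (cos_le_taylor4 1.7 ltac:(lra)); lra.
Qed.

(* With [t = k * x] this makes the derivative in [k] of
   [(k sin x - sin (k x)) / (k^3 - k)] nonpositive, since
   [sin x >= x - x^3 / 6]. *)
Lemma quotient_deriv_trig (k t : R) : 40 <= k -> 0 <= t <= 5.77 ->
  t ^ 3 / 3 - sin t + t * cos t <= k ^ 2 * (2 * t - 3 * sin t + t * cos t).
Proof.
intros hk [h0 hT].
pose proof PI_gt_3; pose proof PI_lt_34_10.
assert (hk2 : 1600 <= k ^ 2) by nra.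
(* Up to [3.4] the Taylor bounds suffice, as [1 - t^2/12] stays positive; from there to
   [5.77 < 2 * PI] sine is nonpositive and [k^2 >= 1600] leaves ample room. *)
destruct (Rle_or_lt t 3.4) as [h | h].
- pose proof (sin_ge_taylor3 t h0); pose proof (sin_le_taylor5 t h0).
  pose proof (cos_le_taylor4 t h0); pose proof (cos_ge_taylor6 t h0).
  assert (h5 : 0 <= t ^ 5) by (apply pow_le; trivial).
  assert (hA : t ^ 5 / 60 * (1 - t ^ 2 / 12) <= 2 * t - 3 * sin t + t * cos t).
    assert (t * (1 - t ^ 2 / 2 + t ^ 4 / 24 - t ^ 6 / 720) <= t * cos t)
      by (apply Rmult_le_compat_l; lra).
    lra.
  assert (hB : t ^ 3 / 3 - sin t + t * cos t <= t ^ 5 / 24).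
    assert (t * cos t <= t * (1 - t ^ 2 / 2 + t ^ 4 / 24))
      by (apply Rmult_le_compat_l; lra).
    lra.
  assert (ht2 : 0.03 <= 1 - t ^ 2 / 12) by nra.
  assert (hA' : t ^ 5 * 0.0005 <= 2 * t - 3 * sin t + t * cos t) by nra.
  nra.
- assert (hs : sin t <= 0) by (apply sin_le_0; lra).
  pose proof (COS_bound t); pose proof (SIN_bound t).
  assert (hA : t <= 2 * t - 3 * sin t + t * cos t) by nra.
  assert (hB : t ^ 3 / 3 - sin t + t * cos t <= t ^ 3 / 3 + 1 + t) by nra.
  assert (t ^ 2 <= 36) by nra.
  assert (t ^ 3 <= 36 * t) by nra.
  nra.
Qed.

Lemma sine_quotient_decreasing (n m x : R) :
  40 <= n -> n < m -> 0 < x -> m * x <= 5.77 ->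
  (m * sin x - sin (m * x)) / (m ^ 3 - m)
    <= (n * sin x - sin (n * x)) / (n ^ 3 - n).
Proof.
intros hn hnm hx hT.
destruct (MVT_cor2 (fun k => (k * sin x - sin (k * x)) / (k ^ 3 - k))
  (fun k => ((sin x - x * cos (k * x)) * (k ^ 3 - k)
    - (k * sin x - sin (k * x)) * (3 * k ^ 2 - 1)) / (k ^ 3 - k) ^ 2) n m hnm)
  as [k [hk hkb]].
- intros k hk; apply is_derive_Reals.
  assert (k ^ 3 - k <> 0).
    replace (k ^ 3 - k) with (k * (k - 1) * (k + 1)) by ring.
    apply Rmult_integral_contrapositive_currified; [ | lra].
    apply Rmult_integral_contrapositive_currified; lra.
  auto_derive.
    repeat split; trivial.
    replace (k * (k * (k * 1)) + - k) with (k ^ 3 - k) by ring; trivial.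
  field; trivial.
(* In the numerator of the derivative the terms in [sin x] collect to [- 2 * k^3 * sin x]; the cubic
   bound for [sin x] then leaves exactly [quotient_deriv_trig] at [t = k * x]. *)
- assert (hN : (sin x - x * cos (k * x)) * (k ^ 3 - k)
    - (k * sin x - sin (k * x)) * (3 * k ^ 2 - 1) <= 0).
  { assert (hkx : 0 <= k * x <= 5.77) by nra.
    pose proof (quotient_deriv_trig k (k * x) ltac:(lra) hkx) as H.
    pose proof (sin_ge_taylor3 x ltac:(lra)) as H1.
    assert (0 < k ^ 3) by (apply pow_lt; lra).
    assert (2 * k ^ 3 * (x - x ^ 3 / 6) <= 2 * k ^ 3 * sin x)
      by (apply Rmult_le_compat_l; lra).
    nra. }
  assert (hP : 0 < k ^ 3 - k) by (assert (1600 <= k ^ 2) by nra; nra).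
  assert (hQ : ((sin x - x * cos (k * x)) * (k ^ 3 - k)
    - (k * sin x - sin (k * x)) * (3 * k ^ 2 - 1)) / (k ^ 3 - k) ^ 2 <= 0).
  { unfold Rdiv.
    assert (0 < / (k ^ 3 - k) ^ 2) by (apply Rinv_0_lt_compat, pow_lt; trivial).
    nra. }
  nra.
Qed.

(** * Convexity of sine beyond PI and its values at the critical arguments *)

Lemma sin_ge_tangent (t0 t : R) : PI <= t0 <= 2 * PI -> PI <= t <= 2 * PI ->
  sin t0 + cos t0 * (t - t0) <= sin t.
Proof.
intros h0 h.
destruct (Rtotal_order t t0) as [hlt | [-> | hgt]]; [ | lra | ].
- destruct (MVT_cor2 sin cos t t0 hlt) as [c [Hc hc]].
    intros; apply derivable_pt_lim_sin.
  assert (cos c <= cos t0) by (apply cos_incr_1; lra); nra.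
- destruct (MVT_cor2 sin cos t0 t hgt) as [c [Hc hc]].
    intros; apply derivable_pt_lim_sin.
  assert (cos t0 <= cos c) by (apply cos_incr_1; lra); nra.
Qed.

Ltac expand_sin_approx H :=
  unfold sin_approx, sin_term in H;
  cbn [sum_f_R0 Nat.mul Nat.add] in H;
  rewrite !fact_simpl, !mult_INR in H;
  change (INR (fact 0)) with 1 in H;
  rewrite !S_INR in H; change (INR 0) with 0 in H;
  cbn [pow] in H.

(** The series bound [pre_sin_bound] reaches only up to 4, so the argument is halved twice: the
    series gives the sines of the half and the quarter, the latter gives the cosine of the half, and
    doubling finishes. *)
Lemma sin_cos_50444 :
  -0.945390 <= sin 5.0444 /\ 0.325944 <= cos 5.0444 <= 0.325946.
Proof.
assert (h1 : 0.95242616 <= sin 1.2611 <= 0.95242617).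
  pose proof (pre_sin_bound 1.2611 2 ltac:(lra) ltac:(lra)) as H.
  expand_sin_approx H; lra.
assert (h2 : 0.5805407 <= sin 2.5222 <= 0.5805408).
  pose proof (pre_sin_bound 2.5222 3 ltac:(lra) ltac:(lra)) as H.
  expand_sin_approx H; lra.
assert (hc : -0.81423122 <= cos 2.5222 <= -0.81423117).
  replace 2.5222 with (2 * 1.2611) by lra; rewrite cos_2a_sin; nra.
replace 5.0444 with (2 * 2.5222) by lra.
rewrite cos_2a_sin, sin_2a; split; nra.
Qed.

Lemma sin_cos_41334 :
  -0.837018 <= sin 4.1334 /\ -0.547179 <= cos 4.1334 <= -0.547177.
Proof.
assert (h1 : 0.85901881 <= sin 1.03335 <= 0.85901882).
  pose proof (pre_sin_bound 1.03335 2 ltac:(lra) ltac:(lra)) as H.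
  expand_sin_approx H; lra.
assert (h2 : 0.8795390 <= sin 2.0667 <= 0.8795391).
  pose proof (pre_sin_bound 2.0667 3 ltac:(lra) ltac:(lra)) as H.
  expand_sin_approx H; lra.
assert (hc : -0.4758267 <= cos 2.0667 <= -0.4758266).
  replace 2.0667 with (2 * 1.03335) by lra; rewrite cos_2a_sin; nra.
replace 4.1334 with (2 * 2.0667) by lra.
rewrite cos_2a_sin, sin_2a; split; nra.
Qed.

(** * Comparison of the sine expressions on (0, PI) *)

(* [5.0444] and [4.1334 ~ 0.8194 * 5.0444] are the critical values of [t] and
   [a * t]; the minimum over the range is only about [9 * 10^-5]. *)
Lemma scaled_sum_nonneg (a t : R) : 0.5 <= a <= 0.8194 -> PI <= t <= 5.77 ->
  0 <= 0.9993 * (a * (1 - a ^ 2)) * t + sin (a * t) + a ^ 3 * sin t.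
Proof.
intros ha ht.
pose proof PI_gt_3; pose proof PI_lt_34_10.
assert (ha3 : 0 <= a ^ 3 <= 0.5502) by (split; nra).
destruct (Rle_or_lt (a * t) PI) as [hu | hu].
- assert (0 <= sin (a * t)) by (apply sin_ge_0; nra).
  pose proof (SIN_bound t).
  assert (0.26 <= a * (1 - a ^ 2)) by nra.
  assert (0.26 * 3 <= a * (1 - a ^ 2) * t) by nra.
  nra.
- destruct sin_cos_50444 as [hs [hc hc']], sin_cos_41334 as [gs [gc gc']].
  assert (hut : a * t <= 4.8) by nra.
  pose proof (sin_ge_tangent 5.0444 t ltac:(lra) ltac:(lra)) as Ht.
  pose proof (sin_ge_tangent 4.1334 (a * t) ltac:(lra) ltac:(lra)) as Hu.
  (* Here and in [Hu'] the constant is lowered by [4 * 10^-6], which absorbs the uncertainty of the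
     slope. *)
  assert (Ht' : -0.945394 + 0.325945 * (t - 5.0444) <= sin t) by nra.
  assert (Hu' : -0.837022 - 0.547178 * (a * t - 4.1334) <= sin (a * t)) by nra.
  (* This is the sum with both sines replaced by their tangents. At the worst [a = 0.8194] the
     bracket is about [2 * 10^-5] and the part without [t] about [-2.4 * 10^-6], which [a * t > 3]
     outweighs. *)
  apply Rle_trans with
    (a * t * (0.452122 - a ^ 2 * 0.673355) + 1.4246835 - a ^ 3 * 2.5895912).
  + assert (ha2 : a ^ 2 <= 0.67141636) by nra.
    assert (ha3' : a ^ 3 <= 0.5501586) by nra.
    assert (0.00002 <= 0.452122 - a ^ 2 * 0.673355) by lra.
    nra.
  + assert (a ^ 3 * (-0.945394 + 0.325945 * (t - 5.0444)) <= a ^ 3 * sin t)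
      by (apply Rmult_le_compat_l; lra).
    nra.
Qed.

Definition limit_ratio (n m : R) : R := (n ^ 3 - n) / (m ^ 3 - m).

Lemma limit_ratio_eq (n m : R) :
  limit_ratio n m = n * (n ^ 2 - 1) / (m * (m ^ 2 - 1)).
Proof.
unfold limit_ratio; f_equal; ring.
Qed.

Lemma ratio_bounds (n m : R) : 81 <= m -> 0.5 * m <= n <= 0.8194 * m ->
  0.5 <= n / m <= 0.8194.
Proof.
intros hm hnm; assert (n = n / m * m) by (field; lra).
split; apply Rmult_le_reg_r with m; lra.
Qed.

(** The ratio of [n^2 - 1] to [m^2 - 1] is below that of the squares since [n < m]. The upper bound
    allows [c] to be replaced by [a^3] where it multiplies a negative sine. *)
Lemma limit_ratio_bounds (n m : R) : 81 <= m -> 0.5 * m <= n <= 0.8194 * m ->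
  0 < limit_ratio n m <= (n / m) ^ 3.
Proof.
intros hm hnm; rewrite limit_ratio_eq; assert (0 < m ^ 2 - 1) by nra; split.
- apply Rdiv_lt_0_compat; nra.
- apply Rle_div_l; [apply Rlt_gt, Rmult_lt_0_compat; lra | ].
  replace ((n / m) ^ 3 * (m * (m ^ 2 - 1)))
    with (n * (n ^ 2 - (n / m) ^ 2)) by (field; lra).
  pose proof (ratio_bounds n m hm hnm).
  apply Rmult_le_compat_l; [lra | ].
  assert ((n / m) ^ 2 <= 1) by nra; lra.
Qed.

(* [0.9993] bounds [m^2 / (m^2 - 1) * (1 - y^2 / 6)] from below for [m >= 81]. *)
Lemma sin_coeff_lower (n m y : R) : 81 <= m -> 0.5 * m <= n <= 0.8194 * m ->
  0 <= y -> m * y <= 5.77 ->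
  0.9993 * (n / m * (1 - (n / m) ^ 2)) * (m * y)
    <= (n - limit_ratio n m * m) * sin y.
Proof.
intros hm hnm hy hT; rewrite limit_ratio_eq; assert (0 < m ^ 2 - 1) by nra.
pose proof (sin_ge_taylor3 y hy).
assert (hK : 0 <= n * (m ^ 2 - n ^ 2) / (m ^ 2 - 1)).
  apply Rdiv_le_0_compat; [apply Rmult_le_pos; [lra | nra] | lra].
apply Rle_trans with
  (n * (m ^ 2 - n ^ 2) / (m ^ 2 - 1) * (y - y ^ 3 / 6)).
- assert (hmy : (m * y) ^ 2 <= 5.77 ^ 2)
    by (apply pow_incr; split; [apply Rmult_le_pos; lra | lra]).
  assert (h2 : 0.9993 * (m ^ 2 - 1) <= m ^ 2 * (1 - y ^ 2 / 6)) by nra.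
  replace (0.9993 * (n / m * (1 - (n / m) ^ 2)) * (m * y))
    with (n * (m ^ 2 - n ^ 2) / (m ^ 2 - 1) * y / m ^ 2
      * (0.9993 * (m ^ 2 - 1))) by (field; lra).
  replace (n * (m ^ 2 - n ^ 2) / (m ^ 2 - 1) * (y - y ^ 3 / 6))
    with (n * (m ^ 2 - n ^ 2) / (m ^ 2 - 1) * y / m ^ 2
      * (m ^ 2 * (1 - y ^ 2 / 6))) by (field; lra).
  apply Rmult_le_compat_l; trivial.
  apply Rdiv_le_0_compat; [apply Rmult_le_pos; trivial | nra].
- replace (n - n * (n ^ 2 - 1) / (m * (m ^ 2 - 1)) * m)
    with (n * (m ^ 2 - n ^ 2) / (m ^ 2 - 1)) by (field; split; lra).
  apply Rmult_le_compat_l; lra.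
Qed.

Lemma near_zero (n m x : R) : 81 <= m -> 0.5 * m <= n <= 0.8194 * m ->
  0 < x -> m * x <= 5.77 ->
  limit_ratio n m * (m * sin x - sin (m * x)) <= n * sin x - sin (n * x).
Proof.
intros hm hnm hx hT.
pose proof (sine_quotient_decreasing n m x ltac:(lra) ltac:(lra) hx hT) as H.
assert (0 < n ^ 3 - n).
  replace (n ^ 3 - n) with (n * (n ^ 2 - 1)) by ring; nra.
unfold limit_ratio.
replace ((n ^ 3 - n) / (m ^ 3 - m) * (m * sin x - sin (m * x)))
  with ((n ^ 3 - n) * ((m * sin x - sin (m * x)) / (m ^ 3 - m)))
  by (unfold Rdiv; ring).
replace (n * sin x - sin (n * x))
  with ((n ^ 3 - n) * ((n * sin x - sin (n * x)) / (n ^ 3 - n)))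
  by (field; lra).
apply Rmult_le_compat_l; lra.
Qed.

Lemma near_PI (n m y : R) : 81 <= m -> 0.5 * m <= n <= 0.8194 * m ->
  0 < y -> m * y <= 5.77 ->
  limit_ratio n m * (m * sin y - sin (m * y)) <= n * sin y + sin (n * y).
Proof.
intros hm hnm hy hT; pose proof PI_gt_3.
pose proof (limit_ratio_bounds n m hm hnm) as [hc hc'].
pose proof (sin_coeff_lower n m y hm hnm ltac:(lra) hT) as Hlow.
destruct (ratio_bounds n m hm hnm) as [ha ha'].
(* Up to [PI] both sines are nonnegative, hence so is every term; beyond it [scaled_sum_nonneg]
   applies with [t = m * y]. *)
destruct (Rle_or_lt (m * y) PI) as [h | h].
- assert (0 <= sin (m * y)) by (apply sin_ge_0; nra).
  assert (0 <= sin (n * y)) by (apply sin_ge_0; nra).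
  assert (0 <= n / m * (1 - (n / m) ^ 2)) by (apply Rmult_le_pos; nra).
  assert (0 <= n / m * (1 - (n / m) ^ 2) * (m * y)) by (apply Rmult_le_pos; nra).
  nra.
- pose proof (scaled_sum_nonneg (n / m) (m * y) ltac:(lra) ltac:(lra)) as H1.
  replace (n / m * (m * y)) with (n * y) in H1 by (field; lra).
  assert (sin (m * y) <= 0) by (apply sin_le_0; lra).
  nra.
Qed.

(* [5.77] is large enough because [1 / (a (1 - a)) - 1 <= 5.758], which bounds
   [(1 + a^3) / (a (1 - a^2))]. *)
Lemma away_from_zeros (n m x : R) : 81 <= m -> 0.5 * m <= n <= 0.8194 * m ->
  5.77 / m <= x <= PI - 5.77 / m ->
  1 + limit_ratio n m <= (n - limit_ratio n m * m) * sin x.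
Proof.
intros hm hnm hx; pose proof PI_gt_3.
pose proof (limit_ratio_bounds n m hm hnm) as [hc hc'].
destruct (ratio_bounds n m hm hnm) as [ha ha'].
assert (hT0 : 0 < 5.77 / m) by (apply Rdiv_lt_0_compat; lra).
assert (hT1 : 5.77 / m <= 1) by (apply Rle_div_l; lra).
assert (hs : sin (5.77 / m) <= sin x).
{ destruct (Rle_or_lt x (PI / 2)) as [h | h].
  - apply sin_incr_1; lra.
  - rewrite <- (sin_PI_x x); apply sin_incr_1; lra. }
assert (hmT : m * (5.77 / m) = 5.77) by (field; lra).
pose proof (sin_coeff_lower n m (5.77 / m) hm hnm ltac:(lra) ltac:(lra)) as Hlow.
rewrite hmT in Hlow.
assert (hK : 0 <= n - limit_ratio n m * m).
{ assert (limit_ratio n m * m <= (n / m) ^ 3 * m) by (apply Rmult_le_compat_r; lra).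
  replace ((n / m) ^ 3 * m) with (n * (n / m) ^ 2) in H0 by (field; lra).
  assert ((n / m) ^ 2 <= 1) by nra.
  assert (n * (n / m) ^ 2 <= n * 1) by (apply Rmult_le_compat_l; lra).
  lra. }
assert ((n - limit_ratio n m * m) * sin (5.77 / m)
    <= (n - limit_ratio n m * m) * sin x)
  by (apply Rmult_le_compat_l; trivial).
set (a := n / m) in *.
(* [6.76596] is [1 + 0.9993 * 5.77] rounded down. Multiplying by [1 + a] gives the claim, because
   [1 + a^3 = (1 + a) - a * (1 - a^2)]. *)
assert (h1 : 1 <= 6.76596 * (a * (1 - a))) by nra.
assert (h2 : (1 + a) * 1 <= (1 + a) * (6.76596 * (a * (1 - a))))
  by (apply Rmult_le_compat_l; lra).
assert (0 <= a * (1 - a) * (1 + a)) by (apply Rmult_le_pos; nra).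
nra.
Qed.

(** * The minimum of f *)

Lemma sin_even_mult_PI_minus (n : nat) (y : R) :
  Nat.Even n -> sin (INR n * (PI - y)) = - sin (INR n * y).
Proof.
intros [k ->]; rewrite <- sin_neg, <- (sin_period (- _) k), mult_INR; f_equal.
simpl (INR 2); ring.
Qed.

Lemma sin_odd_mult_PI_minus (m : nat) (y : R) :
  Nat.Odd m -> sin (INR m * (PI - y)) = sin (INR m * y).
Proof.
intros [k ->]; rewrite <- (sin_PI_x (_ * y)), <- (sin_period (PI - _) k).
rewrite plus_INR, mult_INR; f_equal; simpl (INR 2); simpl (INR 1); ring.
Qed.

Lemma sine_num_comparison (m n : nat) (x : R) :
  Nat.Odd m -> Nat.Even n ->
  81 <= INR m -> 0.5 * INR m <= INR n <= 0.8194 * INR m -> 0 < x < PI ->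
  limit_ratio (INR n) (INR m) * sine_num m x <= sine_num n x.
Proof.
intros hmo hne hm hnm hx; unfold sine_num; pose proof PI_gt_3.
assert (hT : INR m * (5.77 / INR m) = 5.77) by (field; lra).
destruct (Rle_or_lt x (5.77 / INR m)) as [h | h].
  apply near_zero; [lra | lra | lra | ].
  rewrite <- hT; apply Rmult_le_compat_l; lra.
destruct (Rle_or_lt (PI - x) (5.77 / INR m)) as [h' | h'].
  assert (hT' : INR m * (PI - x) <= 5.77)
    by (rewrite <- hT; apply Rmult_le_compat_l; lra).
  assert (hy : 0 < PI - x) by lra.
  pose proof (near_PI (INR n) (INR m) (PI - x) hm hnm hy hT') as H0.
  rewrite (sin_even_mult_PI_minus n), (sin_odd_mult_PI_minus m), sin_PI_x in H0
    by trivial.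
  lra.
pose proof (away_from_zeros (INR n) (INR m) x hm hnm ltac:(lra)).
pose proof (limit_ratio_bounds (INR n) (INR m) hm hnm).
pose proof (SIN_bound (INR n * x)); pose proof (SIN_bound (INR m * x)).
nra.
Qed.

Lemma abs_sin_mult_le (k : nat) (x : R) :
  Rabs (sin (INR k * x)) <= INR k * Rabs (sin x).
Proof.
induction k as [ | k IH].
  simpl; rewrite Rmult_0_l, sin_0, Rabs_R0; lra.
rewrite S_INR, Rmult_plus_distr_r, Rmult_1_l, sin_plus.
eapply Rle_trans; [apply Rabs_triang | ].
rewrite !Rabs_mult.
assert (H : forall y, Rabs (cos y) <= 1)
  by (intros y; apply Rabs_le, COS_bound).
pose proof (H x); pose proof (H (INR k * x)).
pose proof (Rabs_pos (sin x)); pose proof (Rabs_pos (sin (INR k * x))).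
nra.
Qed.

Lemma sine_num_pos (m : nat) (x : R) :
  (2 <= m)%nat -> 0 < sin x -> 0 < sine_num m x.
Proof.
intros hm hs; unfold sine_num.
enough (H : Rabs (sin (INR m * x)) < INR m * sin x)
  by (apply Rabs_lt_between in H; lra).
(* With [m = k + 2], strictness comes from [sin (2 * x)] alone, whose modulus is less than
   [2 * sin x]; the remaining multiple [k] contributes only a weak bound. *)
destruct m as [ | [ | k]]; try lia; clear hm.
rewrite !S_INR.
replace ((INR k + 1 + 1) * x) with (INR k * x + 2 * x) by ring.
rewrite sin_plus, sin_2a, cos_2a.
pose proof (abs_sin_mult_le k x) as Hk.
rewrite (Rabs_pos_eq (sin x)) in Hk by lra.
assert (H2 : Rabs (2 * sin x * cos x) < 2 * sin x).
{ rewrite Rabs_mult, Rabs_pos_eq by lra.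
  assert (Rabs (cos x) < 1).
    apply Rabs_def1; pose proof (sin2_cos2 x) as H; unfold Rsqr in H; nra.
  nra. }
eapply Rle_lt_trans; [apply Rabs_triang | ].
rewrite <- cos_2a, (Rabs_mult (sin _)), (Rabs_mult (cos _)).
assert (H : forall y, Rabs (cos y) <= 1)
  by (intros y; apply Rabs_le, COS_bound).
pose proof (H (2 * x)); pose proof (H (INR k * x)).
pose proof (Rabs_pos (sin (INR k * x))); pose proof (Rabs_pos (2 * sin x * cos x)).
pose proof (Rabs_pos (cos (INR k * x))).
nra.
Qed.

Lemma sin_cos_mult_ext (k : nat) (x y : R) : cos x = cos y -> sin x = sin y ->
  sin (INR k * x) = sin (INR k * y) /\ cos (INR k * x) = cos (INR k * y).
Proof.
intros hc hs; induction k as [ | k [IHs IHc]].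
  simpl; rewrite !Rmult_0_l; auto.
rewrite S_INR, !Rmult_plus_distr_r, !Rmult_1_l, !sin_plus, !cos_plus.
rewrite IHs, IHc, hc, hs; auto.
Qed.

Lemma sine_num_opp (k : nat) (x : R) : sine_num k (- x) = - sine_num k x.
Proof.
unfold sine_num; rewrite Ropp_mult_distr_r_reverse, !sin_neg; ring.
Qed.

(* [sine_num k x / sin x] is a polynomial in [cos x]. *)
Lemma sine_num_reduction (x : R) : sin x <> 0 ->
  exists y e, 0 < y < PI /\ (e = 1 \/ e = -1) /\
    forall k, sine_num k x = e * sine_num k y.
Proof.
intros hs.
set (y := acos (cos x)).
pose proof (COS_bound x) as hcb.
assert (hc : cos y = cos x) by (apply cos_acos; trivial).
assert (hc1 : -1 < cos x < 1).
{ pose proof (sin2_cos2 x) as H; unfold Rsqr in H.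
  assert (0 < sin x * sin x) by nra; split; nra. }
assert (hy : 0 < y < PI) by (apply acos_bound_lt; trivial).
assert (h2 : (sin x - sin y) * (sin x + sin y) = 0).
{ pose proof (sin2_cos2 x) as H1; pose proof (sin2_cos2 y) as H2.
  unfold Rsqr in H1, H2; rewrite hc in H2; lra. }
destruct (Rmult_integral _ _ h2) as [h | h].
- exists y, 1; split; trivial; split; auto; intros k; unfold sine_num.
  destruct (sin_cos_mult_ext k x y) as [-> _]; [lra | lra | ].
  replace (sin x) with (sin y) by lra; ring.
- exists y, (-1); split; trivial; split; auto; intros k.
  replace (-1 * sine_num k y) with (sine_num k (- y))
    by (rewrite sine_num_opp; ring).
  unfold sine_num.
  destruct (sin_cos_mult_ext k x (- y)) as [-> _].
    rewrite cos_neg; lra.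
    rewrite sin_neg; lra.
  rewrite sin_neg; replace (sin x) with (- sin y) by lra; ring.
Qed.

Section Minimum.
Variables m n : nat.
Hypotheses (hmo : Nat.Odd m) (hne : Nat.Even n) (hm : 81 <= INR m)
 (hnm : 0.5 * INR m <= INR n <= 0.8194 * INR m).
Let c := limit_ratio (INR n) (INR m).

Lemma sine_quot_ge (x : R) : sin x <> 0 -> c <= sine_quot m n x.
Proof.
intros hs; unfold sine_quot.
assert (hm2 : (2 <= m)%nat) by (apply INR_le; simpl; lra).
destruct (sine_num_reduction x hs) as [y [e [hy [he H]]]].
rewrite !H.
assert (0 < sine_num m y) by (apply sine_num_pos, sin_gt_0; trivial; apply hy).
replace (e * sine_num n y / (e * sine_num m y))
  with (sine_num n y / sine_num m y) by (destruct he as [-> | ->]; field; lra).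
apply (proj1 (Rle_div_r c _ _ H0)).
apply sine_num_comparison; trivial.
Qed.

Lemma sine_num_neq_0 (x : R) : sin x <> 0 -> sine_num m x <> 0.
Proof.
intros hs.
assert (hm2 : (2 <= m)%nat) by (apply INR_le; simpl; lra).
destruct (sine_num_reduction x hs) as [y [e [hy [he H]]]].
rewrite H.
assert (0 < sine_num m y) by (apply sine_num_pos, sin_gt_0; trivial; apply hy).
destruct he as [-> | ->]; lra.
Qed.

(** [Lim] at a real [x] is the limit along [x + / (INR k + 1)]; these increments lie in [(0, PI)],
    so sine does not vanish at the sampled points when [sin x = 0]. *)
Lemma inv_succ_bounds (k : nat) : 0 < / (INR k + 1) <= 1.
Proof.
pose proof (pos_INR k); split; [apply Rinv_0_lt_compat; lra | ].
rewrite <- Rinv_1; apply Rinv_le_contravar; lra.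
Qed.

Lemma bombieri_f_ge (x : R) : Rbar_le c (bombieri_f m n x).
Proof.
unfold bombieri_f; destruct (Req_EM_T (sine_num m x) 0) as [h0 | h0].
(* The lower bound passes to the limit along the sampling sequence, in [Rbar], so an infinite limit
   is covered too. *)
- rewrite <- (Lim_seq_const c); apply Lim_seq_le_loc; exists 0%nat; intros k _.
  apply sine_quot_ge; simpl.
  assert (hx : sin x = 0).
    destruct (Req_dec (sin x) 0) as [h | h]; trivial.
    now apply sine_num_neq_0 in h.
  rewrite sin_plus, hx.
  pose proof (inv_succ_bounds k); pose proof PI_gt_3.
  assert (0 < sin (/ (INR k + 1))) by (apply sin_gt_0; lra).
  pose proof (sin2_cos2 x) as hx2; unfold Rsqr in hx2; rewrite hx in hx2.
  rewrite Rmult_0_l, Rplus_0_l.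
  apply Rmult_integral_contrapositive_currified; [nra | lra].
- apply sine_quot_ge; intros hx; apply h0; unfold sine_num.
  pose proof (abs_sin_mult_le m x) as H.
  rewrite hx, Rabs_R0, Rmult_0_r in H; apply Rabs_le_between in H; rewrite hx; lra.
Qed.

(** The cubic and quintic Taylor bounds share the factor [x^3/6], which cancels. Together with
    [sine_quot_ge] this squeezes the quotient near 0. *)
Lemma sine_quot_upper (x : R) : 0 < x ->
  0 < INR m ^ 3 - INR m - INR m ^ 5 * x ^ 2 / 20 ->
  sine_quot m n x <= (INR n ^ 3 - INR n + INR n * x ^ 2 / 20)
    / (INR m ^ 3 - INR m - INR m ^ 5 * x ^ 2 / 20).
Proof.
intros hx hd.
assert (hx3 : 0 < x ^ 3 / 6) by (apply Rdiv_lt_0_compat; [apply pow_lt | ]; lra).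
assert (hn : sine_num n x <= x ^ 3 / 6 * (INR n ^ 3 - INR n + INR n * x ^ 2 / 20)).
{ unfold sine_num.
  pose proof (sin_le_taylor5 x ltac:(lra)).
  pose proof (sin_ge_taylor3 (INR n * x) ltac:(nra)).
  assert (INR n * sin x <= INR n * (x - x ^ 3 / 6 + x ^ 5 / 120))
    by (apply Rmult_le_compat_l; lra).
  lra. }
assert (hm' : x ^ 3 / 6 * (INR m ^ 3 - INR m - INR m ^ 5 * x ^ 2 / 20)
  <= sine_num m x).
{ unfold sine_num.
  pose proof (sin_ge_taylor3 x ltac:(lra)).
  pose proof (sin_le_taylor5 (INR m * x) ltac:(nra)).
  assert (INR m * (x - x ^ 3 / 6) <= INR m * sin x)
    by (apply Rmult_le_compat_l; lra).
  lra. }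
unfold sine_quot.
set (N := INR n ^ 3 - INR n + INR n * x ^ 2 / 20) in *.
set (D := INR m ^ 3 - INR m - INR m ^ 5 * x ^ 2 / 20) in *.
assert (hN : 0 <= N).
{ unfold N; replace (INR n ^ 3 - INR n + INR n * x ^ 2 / 20)
    with (INR n * (INR n ^ 2 - 1 + x ^ 2 / 20)) by field.
  apply Rmult_le_pos; nra. }
assert (0 < x ^ 3 / 6 * D) by (apply Rmult_lt_0_compat; trivial).
apply Rle_div_l; [lra | ].
apply Rle_trans with (x ^ 3 / 6 * N); trivial.
replace (x ^ 3 / 6 * N) with (N / D * (x ^ 3 / 6 * D)) by (field; lra).
apply Rmult_le_compat_l; trivial.
apply Rdiv_le_0_compat; trivial.
Qed.

Lemma bombieri_f_0 : bombieri_f m n 0 = c.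
Proof.
unfold bombieri_f; destruct (Req_EM_T (sine_num m 0) 0) as [_ | h0].
2: { exfalso; apply h0; unfold sine_num; rewrite Rmult_0_r, sin_0; ring. }
apply is_lim_seq_unique.
pose (g := fun x => (INR n ^ 3 - INR n + INR n * x ^ 2 / 20)
    / (INR m ^ 3 - INR m - INR m ^ 5 * x ^ 2 / 20)).
assert (hD : 0 < INR m ^ 3 - INR m).
  replace (INR m ^ 3 - INR m) with (INR m * (INR m ^ 2 - 1)) by ring.
  apply Rmult_lt_0_compat; nra.
assert (hu : is_lim_seq (fun k => / (INR k + 1)) 0).
  apply (is_lim_seq_inv _ p_infty); [ | easy].
  apply (is_lim_seq_plus _ _ p_infty 1 p_infty);
    [apply is_lim_seq_INR | apply is_lim_seq_const | easy].
apply is_lim_seq_le_le_loc with (u := fun _ => c)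
  (w := fun k => g (/ (INR k + 1))).
- pose (d := fun x => INR m ^ 3 - INR m - INR m ^ 5 * x ^ 2 / 20).
  assert (hd0 : d 0 = INR m ^ 3 - INR m) by (unfold d; field).
  assert (hD' : is_lim_seq (fun k => d (/ (INR k + 1))) (d 0)).
  { apply (is_lim_seq_continuous d _ 0); trivial.
    apply derivable_continuous_pt, ex_derive_Reals_0; unfold d.
    auto_derive; trivial. }
  rewrite hd0 in hD'.
  apply is_lim_seq_spec in hD'.
  (* The tolerance is the limit [m^3 - m] itself, which makes the denominator eventually
     positive. *)
  destruct (hD' (mkposreal _ hD)) as [N HN]; exists N; intros k hk.
  specialize (HN k hk); simpl pos in HN; apply Rabs_lt_between in HN.
  pose proof (inv_succ_bounds k); pose proof PI_gt_3; simpl Rbar_loc_seq.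
  rewrite Rplus_0_l; split.
    apply sine_quot_ge; apply Rgt_not_eq, sin_gt_0; lra.
  apply sine_quot_upper; [lra | unfold d in HN; lra].
- apply is_lim_seq_const.
- replace c with (g 0) by (unfold g, c, limit_ratio; field; simpl; lra).
  apply (is_lim_seq_continuous g _ 0); trivial.
  apply derivable_continuous_pt, ex_derive_Reals_0; unfold g; auto_derive.
  simpl; lra.
Qed.

End Minimum.

(** * Rotations of the Koebe function *)

Definition cis (t : R) : C := (cos t, sin t).

Lemma Cmod_cis (t : R) : Cmod (cis t) = 1.
Proof.
unfold Cmod, cis; simpl fst; simpl snd.
replace (cos t ^ 2 + sin t ^ 2) with 1; [apply sqrt_1 | ].
pose proof (sin2_cos2 t) as H; unfold Rsqr in H; lra.
Qed.

Lemma cis_pow (t : R) (k : nat) : (cis t ^ k)%C = cis (INR k * t).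
Proof.
induction k as [ | k IH].
  simpl; unfold cis; rewrite Rmult_0_l, cos_0, sin_0; reflexivity.
rewrite Cpow_S, IH, S_INR, Rmult_plus_distr_r, Rmult_1_l.
unfold cis, Cmult; simpl; rewrite cos_plus, sin_plus; f_equal; ring.
Qed.

Lemma Cmod_cis_minus_1 (t : R) : 0 <= t -> Cmod (cis t - 1) <= t.
Proof.
intros ht; unfold Cmod; apply Rle_trans with (sqrt (t ^ 2)).
- apply sqrt_le_1_alt; unfold cis; simpl fst; simpl snd.
  pose proof (sin2_cos2 t) as H; unfold Rsqr in H.
  pose proof (cos_ge_taylor2 t ht); lra.
- rewrite sqrt_pow2; lra.
Qed.

Lemma Cmod_1_minus_ge (z : C) (r : R) : Cmod z <= r -> 1 - r <= Cmod (1 - z).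
Proof.
intros hz.
pose proof (Cmod_triangle (1 - z) z) as H.
replace (1 - z + z)%C with (RtoC 1) in H by ring.
rewrite Cmod_1 in H; lra.
Qed.

Lemma Cmod_minus_le (x y : C) : Cmod (x - y) <= Cmod x + Cmod y.
Proof.
rewrite <- (Cmod_opp y); apply Cmod_triangle.
Qed.

Lemma Cminus_neq_0 (z : C) : Cmod z < 1 -> (1 - z)%C <> 0.
Proof.
intros hz h; pose proof (Cmod_1_minus_ge z (Cmod z) (Rle_refl _)) as H.
rewrite h, Cmod_0 in H; lra.
Qed.

Lemma Cmult_integral (x y : C) : (x * y = 0)%C -> x = 0 \/ y = 0.
Proof.
intros h; apply (f_equal Cmod) in h; rewrite Cmod_mult, Cmod_0 in h.
apply Rmult_integral in h as [h | h]; apply Cmod_eq_0 in h; auto.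
Qed.

(** For [w] of modulus 1 this is the rotation [koebe (w * z) / w]. *)
Definition rot_koebe (w z : C) : C := (z / ((1 - w * z) * (1 - w * z)))%C.

Section Rotation.
Variable w : C.
Hypothesis hw : Cmod w = 1.

Lemma Cmod_rot (z : C) : Cmod (w * z) = Cmod z.
Proof. rewrite Cmod_mult, hw; ring. Qed.

Lemma rot_denom_neq_0 (z : C) : Cmod z < 1 -> (1 - w * z)%C <> 0.
Proof. rewrite <- Cmod_rot; apply Cminus_neq_0. Qed.

(** After clearing denominators the difference of two values is [(x - y) * (1 - w * x * (w * y))],
    whose second factor does not vanish in the disk. *)
Lemma rot_koebe_univalent : univalent_disk (rot_koebe w).
Proof.
intros x y hx hy; unfold in_disk in hx, hy; unfold rot_koebe; intros h.
pose proof (rot_denom_neq_0 x hx); pose proof (rot_denom_neq_0 y hy).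
assert (hxy : (1 - w * x * (w * y))%C <> 0).
  apply Cminus_neq_0; rewrite Cmod_mult, !Cmod_rot.
  pose proof (Cmod_ge_0 x); pose proof (Cmod_ge_0 y); nra.
assert (h' : ((x - y) * (1 - w * x * (w * y)) = 0)%C).
{ replace ((x - y) * (1 - w * x * (w * y)))%C
    with ((x / ((1 - w * x) * (1 - w * x)) - y / ((1 - w * y) * (1 - w * y)))
      * ((1 - w * x) * (1 - w * x) * ((1 - w * y) * (1 - w * y))))%C
    by (field; split; trivial).
  rewrite h; ring. }
apply Cmult_integral in h' as [h' | h']; [ | contradiction].
replace x with (x - y + y)%C by ring; rewrite h'; ring.
Qed.

Lemma rot_koebe_holomorphic : holomorphic_disk (rot_koebe w).
Proof.
intros x hx; unfold in_disk in hx.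
exists ((1 + w * x) / ((1 - w * x) * (1 - w * x) * (1 - w * x)))%C.
split; [apply (@is_linear_scal_l C_AbsRing C_NormedModule) | ].
intros x' hx' eps.
apply (@is_filter_lim_locally_unique _ (AbsRing_NormedModule C_AbsRing)) in hx'.
subst x'.
set (d := 1 - Cmod x); assert (hd : 0 < d) by (unfold d; lra).
(* The remainder of the linear approximation is [(y - x)^2] times a quotient with numerator at most
   4 and denominator at least [d^3 * (d/2)^2] once [y] is within [d/2] of [x]; this bounds the
   quotient by [M]. *)
set (M := 16 / d ^ 5).
assert (hM : 0 < M) by (apply Rdiv_lt_0_compat; [lra | apply pow_lt, hd]).
assert (hdel : 0 < Rmin (d / 2) (eps / M)).
  apply Rmin_case; [lra | apply Rdiv_lt_0_compat; [apply eps | lra]].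
exists (mkposreal _ hdel); intros y hy.
change (Cmod (y - x) < Rmin (d / 2) (eps / M)) in hy.
pose proof (Rlt_le_trans _ _ _ hy (Rmin_l _ _)) as hy1.
pose proof (Rlt_le_trans _ _ _ hy (Rmin_r _ _)) as hy2.
assert (hyd : Cmod y <= 1 - d / 2).
  replace y with (x + (y - x))%C by ring.
  eapply Rle_trans; [apply Cmod_triangle | unfold d in *; lra].
pose proof (rot_denom_neq_0 x hx); pose proof (rot_denom_neq_0 y ltac:(lra)).
change (Cmod (rot_koebe w y - rot_koebe w x
  - (y - x) * ((1 + w * x) / ((1 - w * x) * (1 - w * x) * (1 - w * x))))
  <= eps * Cmod (y - x)).
replace (rot_koebe w y - rot_koebe w x
  - (y - x) * ((1 + w * x) / ((1 - w * x) * (1 - w * x) * (1 - w * x))))%C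
  with ((y - x) * ((y - x) * (w * (2 - w * y - w * x * (w * y))
    / ((1 - w * x) * (1 - w * x) * (1 - w * x)
       * ((1 - w * y) * (1 - w * y))))))%C
  by (unfold rot_koebe; field; split; trivial).
rewrite Cmod_mult, (Rmult_comm eps).
apply Rmult_le_compat_l; [apply Cmod_ge_0 | ].
rewrite Cmod_mult.
assert (hq : Cmod (w * (2 - w * y - w * x * (w * y))
    / ((1 - w * x) * (1 - w * x) * (1 - w * x)
       * ((1 - w * y) * (1 - w * y)))) <= M).
{ rewrite Cmod_div by (repeat apply Cmult_neq_0; trivial).
  rewrite !Cmod_mult, hw, Rmult_1_l.
  assert (hnum : Cmod (2 - w * y - w * x * (w * y)) <= 4).
  { eapply Rle_trans; [apply Cmod_minus_le | ].
    rewrite Cmod_mult, !Cmod_rot.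
    pose proof (Cmod_minus_le 2 (w * y)) as H1.
    rewrite Cmod_rot, Cmod_R, Rabs_pos_eq in H1 by lra.
    pose proof (Cmod_ge_0 x); pose proof (Cmod_ge_0 y); nra. }
  assert (h1 : d <= Cmod (1 - w * x))
    by (apply Cmod_1_minus_ge; rewrite Cmod_rot; apply Rle_refl).
  assert (h2 : d / 2 <= Cmod (1 - w * y)).
    replace (d / 2) with (1 - (1 - d / 2)) by ring.
    apply Cmod_1_minus_ge; rewrite Cmod_rot; trivial.
  replace M with (4 / (d * d * d * (d / 2 * (d / 2))))
    by (unfold M; field; lra).
  apply Rmult_le_compat; trivial.
  - apply Cmod_ge_0.
  - apply Rlt_le, Rinv_0_lt_compat; repeat apply Rmult_lt_0_compat; lra.
  - apply Rinv_le_contravar; [repeat apply Rmult_lt_0_compat; lra | ].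
    repeat apply Rmult_le_compat; try lra; repeat apply Rmult_le_pos; lra. }
apply Rle_trans with (eps / M * M); [ | right; field; lra].
apply Rmult_le_compat; try apply Cmod_ge_0; lra.
Qed.

(** At [k = 0] the truncated exponent is harmless, as the factor [INR 0] vanishes. *)
Definition rot_coeff (k : nat) : C := (RtoC (INR k) * w ^ pred k)%C.

Lemma pow_n_Cpow (z : C) (k : nat) :
  @pow_n C_AbsRing z k = (z ^ k)%C.
Proof.
induction k as [ | k IH]; [reflexivity | ].
simpl; rewrite IH; reflexivity.
Qed.

(** Closed form of an arithmetic-geometric sum; it reduces convergence to that of [N * r^N] to 0. *)
Lemma rot_koebe_partial_sum (z : C) (N : nat) : Cmod z < 1 ->
  sum_n (fun k => @scal C_AbsRing C_NormedModule (@pow_n C_AbsRing z k)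
    (rot_coeff k)) N
  = (rot_koebe w z * (1 - RtoC (INR N + 1) * (w * z) ^ N
      + RtoC (INR N) * (w * z) ^ S N))%C.
Proof.
intros hz; pose proof (rot_denom_neq_0 z hz); unfold rot_koebe.
induction N as [ | N IH].
- rewrite sum_O; unfold rot_coeff; simpl.
  change (1 * (0 * 1) = z / ((1 - w * z) * (1 - w * z))
    * (1 - RtoC (0 + 1) * 1 + 0 * (w * z * 1)))%C.
  rewrite Rplus_0_l; field; trivial.
- rewrite sum_Sn, IH.
  match goal with |- @plus ?G ?a (@scal _ _ ?p ?c) = ?r =>
    change ((a + p * c)%C = r) end.
  rewrite (pow_n_Cpow z (S N)); unfold rot_coeff; simpl pred.
  rewrite !S_INR, !Cpow_S, !Cpow_mult_l, !RtoC_plus.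
  field; trivial.
Qed.

(** [1 - s^N] is [1 - s] times a geometric sum of [N] terms, each at least [s^N]. *)
Lemma INR_mult_pow_le (s : R) (N : nat) : 0 <= s <= 1 ->
  INR N * (1 - s) * s ^ N <= 1 - s ^ N.
Proof.
intros hs; induction N as [ | N IH]; [simpl; lra | ].
rewrite S_INR; simpl pow.
assert (0 <= s ^ N <= 1).
  split; [apply pow_le; lra | rewrite <- (pow1 N); apply pow_incr; lra].
assert (s * (INR N * (1 - s) * s ^ N) <= s * (1 - s ^ N))
  by (apply Rmult_le_compat_l; lra).
assert (s * s ^ N <= 1) by nra.
nra.
Qed.

Lemma is_lim_seq_INR_mult_pow (r : R) : 0 <= r < 1 ->
  is_lim_seq (fun N => INR N * r ^ N) 0.
Proof.
(* Writing [r^N = s^N * s^N], one factor bounds [INR N * s^N] by [/ (1 - s)] and the other tends to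
   0. *)
intros hr; set (s := sqrt r).
assert (hs0 : 0 <= s) by apply sqrt_pos.
assert (hs2 : s * s = r) by (apply sqrt_sqrt; lra).
assert (hs1 : s < 1) by nra.
apply is_lim_seq_le_le with (u := fun _ => 0)
  (w := fun N => / (1 - s) * s ^ N).
- intros N; pose proof (pos_INR N); pose proof (pow_le s N hs0).
  rewrite <- hs2, Rpow_mult_distr; split; [repeat apply Rmult_le_pos; trivial | ].
  rewrite <- Rmult_assoc; apply Rmult_le_compat_r; trivial.
  apply Rmult_le_reg_l with (1 - s); [lra | ].
  rewrite Rinv_r by lra.
  pose proof (INR_mult_pow_le s N ltac:(lra)); lra.
- apply is_lim_seq_const.
- replace (Finite 0) with (Rbar_mult (/ (1 - s)) 0) by (simpl; f_equal; ring).
  apply is_lim_seq_scal_l, is_lim_seq_geom; rewrite Rabs_pos_eq; trivial.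
Qed.

Lemma rot_koebe_taylor : taylor_coeffs (rot_koebe w) rot_coeff.
Proof.
intros z hz; unfold in_disk in hz.
apply filterlim_locally; intros eps.
set (L := Cmod (rot_koebe w z)).
pose proof (Cmod_ge_0 z); assert (hL : 0 <= L) by apply Cmod_ge_0.
assert (hlim : is_lim_seq
  (fun N => L * (2 * (INR N * Cmod z ^ N) + Cmod z ^ N)) 0).
{ replace (Finite 0) with (Rbar_mult L (Rbar_plus (Rbar_mult 2 0) 0))
    by (simpl; f_equal; ring).
  apply is_lim_seq_scal_l, is_lim_seq_plus'.
  - apply (is_lim_seq_scal_l _ 2 0), is_lim_seq_INR_mult_pow; lra.
  - apply is_lim_seq_geom; rewrite Rabs_pos_eq; trivial. }
apply is_lim_seq_spec in hlim; destruct (hlim eps) as [N0 HN0].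
exists N0; intros N hN; specialize (HN0 N hN).
apply C_NormedModule_mixin_compat1; rewrite rot_koebe_partial_sum by trivial.
change (Cmod (rot_koebe w z * (1 - RtoC (INR N + 1) * (w * z) ^ N
      + RtoC (INR N) * (w * z) ^ S N) - rot_koebe w z) < eps).
replace (rot_koebe w z * (1 - RtoC (INR N + 1) * (w * z) ^ N
      + RtoC (INR N) * (w * z) ^ S N) - rot_koebe w z)%C
  with (rot_koebe w z * (RtoC (INR N) * (w * z) ^ S N
     - RtoC (INR N + 1) * (w * z) ^ N))%C by ring.
rewrite Cmod_mult; fold L.
eapply Rle_lt_trans; [ | eapply Rle_lt_trans; [apply Rle_abs | exact HN0]].
rewrite Rminus_0_r; apply Rmult_le_compat_l; trivial.
eapply Rle_trans; [apply Cmod_minus_le | ].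
rewrite !Cmod_mult, !Cmod_pow, !Cmod_rot, !Cmod_R.
pose proof (pos_INR N); rewrite !Rabs_pos_eq by lra; simpl pow.
pose proof (pow_le (Cmod z) N ltac:(lra)) as hp.
assert (0 <= INR N * Cmod z ^ N) by (apply Rmult_le_pos; trivial).
nra.
Qed.

Lemma rot_koebe_class_S : class_S (rot_koebe w).
Proof.
split; [apply rot_koebe_holomorphic | split; [apply rot_koebe_univalent | ]].
exists rot_coeff; split; [apply rot_koebe_taylor | ].
unfold rot_coeff; simpl; split; ring.
Qed.

(** The difference carries the factor [w - 1]; its cofactor has numerator at most 4 and four
    denominator factors of modulus at least [1 - r]. *)
Lemma rot_koebe_near (r : R) (z : C) : r < 1 -> Cmod z <= r ->
  Cmod (rot_koebe w z - koebe z) <= Cmod (w - 1) * (4 / (1 - r) ^ 4).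
Proof.
intros hr hz; unfold rot_koebe, koebe.
pose proof (rot_denom_neq_0 z ltac:(lra)); pose proof (Cminus_neq_0 z ltac:(lra)).
replace (z / ((1 - w * z) * (1 - w * z)) - z / ((1 - z) * (1 - z)))%C
  with ((w - 1) * (z * z * (2 - z - w * z)
    / ((1 - z) * (1 - z) * ((1 - w * z) * (1 - w * z)))))%C
  by (field; split; trivial).
rewrite Cmod_mult; apply Rmult_le_compat_l; [apply Cmod_ge_0 | ].
rewrite Cmod_div by (repeat apply Cmult_neq_0; trivial).
rewrite !Cmod_mult.
pose proof (Cmod_ge_0 z).
pose proof (Cmod_1_minus_ge z r hz) as h1.
assert (h2 : 1 - r <= Cmod (1 - w * z))
  by (apply Cmod_1_minus_ge; rewrite Cmod_rot; trivial).
assert (hnum : Cmod (2 - z - w * z) <= 4).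
{ eapply Rle_trans; [apply Cmod_minus_le | ].
  pose proof (Cmod_minus_le 2 z) as H3.
  rewrite Cmod_R, Rabs_pos_eq in H3 by lra; rewrite Cmod_rot; lra. }
pose proof (Cmod_ge_0 (2 - z - w * z)).
replace ((1 - r) ^ 4) with ((1 - r) * (1 - r) * ((1 - r) * (1 - r))) by ring.
apply Rmult_le_compat.
- repeat apply Rmult_le_pos; trivial.
- apply Rlt_le, Rinv_0_lt_compat; repeat apply Rmult_lt_0_compat; lra.
- assert (Cmod z * Cmod z <= 1) by nra; nra.
- apply Rinv_le_contravar; [repeat apply Rmult_lt_0_compat; lra | ].
  repeat apply Rmult_le_compat; try lra; repeat apply Rmult_le_pos; lra.
Qed.

Lemma rot_koebe_neq : w <> 1 ->
  ~ (forall z, in_disk z -> rot_koebe w z = koebe z).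
Proof.
intros hw1 h.
assert (hhalf : Cmod (RtoC (1 / 2)) = 1 / 2)
  by (rewrite Cmod_R; apply Rabs_pos_eq; lra).
(* Equality at [1/2] forces [w = 1], [z = 0] or [z + w * z = 2]; the last fails as its left side has
   modulus at most 1. *)
set (z := RtoC (1 / 2)) in *.
assert (hz : Cmod z < 1) by lra.
specialize (h z hz); unfold rot_koebe, koebe in h.
pose proof (rot_denom_neq_0 z hz) as H1; pose proof (Cminus_neq_0 z hz) as H2.
assert (h' : ((w - 1) * (z * (z * (2 - z - w * z))) = 0)%C).
{ replace ((w - 1) * (z * (z * (2 - z - w * z))))%C
    with ((z / ((1 - w * z) * (1 - w * z)) - z / ((1 - z) * (1 - z)))
      * ((1 - z) * (1 - z) * ((1 - w * z) * (1 - w * z))))%C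
    by (field; split; trivial).
  rewrite h; ring. }
assert (hz0 : z <> 0) by (apply Cmod_gt_0; lra).
apply Cmult_integral in h' as [h' | h'].
  apply hw1; replace w with (w - 1 + 1)%C by ring; rewrite h'; ring.
apply Cmult_integral in h' as [h' | h']; [contradiction | ].
apply Cmult_integral in h' as [h' | h']; [contradiction | ].
pose proof (Cmod_triangle z (w * z)) as H3.
replace (z + w * z)%C with (RtoC 2 - (2 - z - w * z))%C in H3 by ring.
rewrite h', Cmod_rot, hhalf in H3.
replace (2 - 0)%C with (RtoC 2) in H3 by ring.
rewrite Cmod_R, Rabs_pos_eq in H3; lra.
Qed.

End Rotation.

(** * Upper bound for sigma from the rotations *)

(** The open disks of radius [1 - / (INR k + 1)] cover [A]; the largest index in a finite subcover
    gives the radius. *)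
Lemma compact_in_disk_bounded (A : C -> Prop) :
  compact_set A -> (forall z, A z -> in_disk z) ->
  exists r, r < 1 /\ forall z, A z -> Cmod z <= r.
Proof.
intros hA hd.
destruct (hA nat (fun k z => Cmod z < 1 - / (INR k + 1))) as [l hl].
- intros k z hz.
  (* Balls of [C_UniformSpace] are squares: the modulus is bounded by the sum of the two coordinate
     distances, hence the division by 2. *)
  assert (he : 0 < (1 - / (INR k + 1) - Cmod z) / 2) by lra.
  exists (mkposreal _ he); intros y hy.
  destruct hy as [hy1 hy2].
  change (Rabs (fst y - fst z) < (1 - / (INR k + 1) - Cmod z) / 2) in hy1.
  change (Rabs (snd y - snd z) < (1 - / (INR k + 1) - Cmod z) / 2) in hy2.
  replace y with (z + (RtoC (fst y - fst z) + Ci * RtoC (snd y - snd z)))%C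
    by (destruct y, z; unfold Cplus, Cmult, Ci, RtoC; simpl; f_equal; ring).
  eapply Rle_lt_trans; [apply Cmod_triangle | ].
  pose proof (Cmod_triangle (RtoC (fst y - fst z)) (Ci * RtoC (snd y - snd z))) as H.
  rewrite Cmod_mult, Cmod_Ci, !Cmod_R in H; lra.
- intros z hz; specialize (hd z hz); unfold in_disk in hd.
  destruct (nfloor_ex (/ (1 - Cmod z))) as [k [_ hk]].
    apply Rlt_le, Rinv_0_lt_compat; lra.
  exists k.
  apply Rinv_lt_contravar in hk.
    rewrite Rinv_inv in hk; lra.
  pose proof (pos_INR k).
  apply Rmult_lt_0_compat; [apply Rinv_0_lt_compat | ]; lra.
- exists (1 - / (INR (list_max l) + 1)); pose proof (pos_INR (list_max l)); split.
    assert (0 < / (INR (list_max l) + 1)) by (apply Rinv_0_lt_compat; lra); lra.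
  intros z hz; destruct (hl z hz) as [k [hk hkz]].
  assert (k <= list_max l)%nat.
    pose proof (proj1 (list_max_le l _) (Nat.le_refl _)) as H0.
    rewrite Forall_forall in H0; apply H0, hk.
  apply le_INR in H0; pose proof (pos_INR k).
  assert (/ (INR (list_max l) + 1) <= / (INR k + 1))
    by (apply Rinv_le_contravar; lra).
  lra.
Qed.

Lemma Re_rot_coeff (t : R) (k : nat) : (1 <= k)%nat ->
  INR k - Re (rot_coeff (cis t) k) = INR k * (1 - cos ((INR k - 1) * t)).
Proof.
intros hk; unfold rot_coeff; rewrite cis_pow.
destruct k as [ | k]; [lia | ]; simpl pred; rewrite S_INR.
replace (INR k + 1 - 1) with (INR k) by ring.
unfold cis, Cmult, RtoC, Re; simpl; ring.
Qed.

Lemma Rbar_glb_le (E : Rbar -> Prop) (x : Rbar) :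
  E x -> Rbar_le (Rbar_glb E) x.
Proof.
unfold Rbar_glb; destruct Rbar_ex_glb as [v hv]; apply (proj1 hv).
Qed.

(** The hypothesis says that the limit of the coefficient quotients of the rotations is below [c].
    Every neighbourhood of the Koebe function contains a rotation with quotient at most [c], so
    every infimum is at most [c]. *)
Lemma bombieri_sigma_le (m n : nat) (c : R) : (2 <= m)%nat -> (1 <= n)%nat ->
  INR n * (INR n - 1) ^ 2 < c * (INR m * (INR m - 1) ^ 2) ->
  Rbar_le (bombieri_sigma m n) c.
Proof.
intros hm hn hc.
apply le_INR in hm as hmR; apply le_INR in hn as hnR; simpl in hmR, hnR.
unfold bombieri_sigma, Rbar_lub; destruct Rbar_ex_lub as [v hv].
apply (proj2 hv); intros l [A [eps [hA [hd [heps ->]]]]].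
destruct (compact_in_disk_bounded A hA hd) as [r [hr hAr]].
assert (hM : 0 < INR m * (INR m - 1) ^ 2)
  by (apply Rmult_lt_0_compat; [ | apply pow_lt]; lra).
assert (hcpos : 0 < c).
{ assert (0 <= INR n * (INR n - 1) ^ 2)
    by (apply Rmult_le_pos; [lra | apply pow2_ge_0]).
  nra. }
assert (hr4 : 0 < (1 - r) ^ 4) by (apply pow_lt; lra).
(* With [s] below, the Taylor bounds for the two cosines leave the margin
   [t^2/24 * (12 * s - K * t^2)]. *)
set (K := c * (INR m * (INR m - 1) ^ 2) * (INR m - 1) ^ 2).
assert (hK : 0 < K).
  repeat apply Rmult_lt_0_compat; trivial; try apply pow_lt; lra.
set (s := c * (INR m * (INR m - 1) ^ 2) - INR n * (INR n - 1) ^ 2).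
assert (hs : 0 < s) by (unfold s; lra).
(* The first entry keeps [(INR m - 1) * t] at most 1, the second keeps the rotation within [eps / 2]
   of the Koebe function on [A], the third makes the margin nonnegative, since [t^2 <= t]. *)
set (t := Rmin (/ INR m) (Rmin (eps * (1 - r) ^ 4 / 8) (12 * s / K))).
assert (ht : 0 < t).
{ unfold t; apply Rmin_case; [apply Rinv_0_lt_compat; lra | ].
  apply Rmin_case; apply Rdiv_lt_0_compat; try lra.
  apply Rmult_lt_0_compat; lra. }
assert (ht1 : t <= / INR m) by apply Rmin_l.
assert (ht2 : t <= eps * (1 - r) ^ 4 / 8)
  by (eapply Rle_trans; [apply Rmin_r | apply Rmin_l]).
assert (ht3 : t <= 12 * s / K)
  by (eapply Rle_trans; [apply Rmin_r | apply Rmin_r]).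
assert (htm : INR m * t <= 1).
{ replace 1 with (INR m * / INR m) by (field; lra).
  apply Rmult_le_compat_l; lra. }
eapply Rbar_le_trans with (y := Finite ((INR n - Re (rot_coeff (cis t) n))
  / (INR m - Re (rot_coeff (cis t) m)))).
- apply Rbar_glb_le.
  exists (rot_koebe (cis t)), (rot_coeff (cis t)).
  pose proof (Cmod_cis t) as hw.
  split; [apply rot_koebe_class_S; trivial | ].
  split; [apply rot_koebe_taylor; trivial | ].
  split; [ | split; trivial].
  + apply rot_koebe_neq; trivial; intros h; injection h as h _.
    pose proof (cos_le_taylor4 t ltac:(lra)).
    assert (t <= 1) by nra.
    assert (0 < t ^ 2 <= 1) by nra; nra.
  + intros z hz; eapply Rle_lt_trans.
      apply (rot_koebe_near (cis t) hw r z hr (hAr z hz)).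
    apply Rle_lt_trans with (eps * (1 - r) ^ 4 / 8 * (4 / (1 - r) ^ 4)).
      apply Rmult_le_compat_r; [apply Rlt_le, Rdiv_lt_0_compat; lra | ].
      eapply Rle_trans; [apply Cmod_cis_minus_1; lra | trivial].
    replace (eps * (1 - r) ^ 4 / 8 * (4 / (1 - r) ^ 4)) with (eps / 2)
      by (field; lra).
    lra.
- rewrite !Re_rot_coeff by lia; simpl.
  set (y := (INR m - 1) * t); set (x := (INR n - 1) * t).
  assert (hy : 0 < y) by (apply Rmult_lt_0_compat; lra).
  assert (hy1 : y <= 1) by (unfold y; lra).
  assert (hx0 : 0 <= x) by (apply Rmult_le_pos; lra).
  pose proof (cos_ge_taylor2 x hx0) as hx.
  pose proof (cos_le_taylor4 y ltac:(lra)) as hcy.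
  assert (hy2 : 0 < y ^ 2 <= 1) by nra.
  assert (0 < 1 - cos y) by nra.
  assert (hden : INR m * (1 - cos y) > 0) by (apply Rmult_lt_0_compat; lra).
  apply (proj2 (Rle_div_l _ c _ hden)).
  apply Rle_trans with (INR n * (x ^ 2 / 2)).
    apply Rmult_le_compat_l; lra.
  apply Rle_trans with (c * (INR m * (y ^ 2 / 2 - y ^ 4 / 24))).
  2: { apply Rmult_le_compat_l; [lra | ]; apply Rmult_le_compat_l; lra. }
  assert (hts : K * t ^ 2 <= 12 * s).
  { apply Rle_trans with (K * (12 * s / K)); [ | right; field; lra].
    apply Rmult_le_compat_l; [lra | ].
    apply Rle_trans with t; trivial.
    assert (t <= 1) by nra; nra. }
  assert (h : 0 <= t ^ 2 / 24 * (12 * s - K * t ^ 2))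
    by (apply Rmult_le_pos; [ | lra]; pose proof (pow2_ge_0 t); lra).
  unfold s, K in h; unfold x, y; lra.
Qed.

(** * Failure of the conjectured equality *)

Lemma bombieri_B_eq_min (m n : nat) (x : R) :
  is_min_at (bombieri_f m n) x -> bombieri_B m n = bombieri_f m n x.
Proof.
intros h; apply Rbar_is_glb_unique; split.
- intros v [y ->]; apply h.
- intros l hl; apply hl; exists x; trivial.
Qed.

(** After cancellation this is [(m + 1) * (n - 1) < (n + 1) * (m - 1)], whose sides differ by
    [2 * (m - n)]. *)
Lemma rotation_ratio_lt (n m : R) : 1 < n < m ->
  n * (n - 1) ^ 2 < limit_ratio n m * (m * (m - 1) ^ 2).
Proof.
intros h; unfold limit_ratio.
assert (hp : 0 < n * (n - 1)) by (apply Rmult_lt_0_compat; lra).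
assert (hd : (m + 1) * (n - 1) < (n + 1) * (m - 1)) by lra.
replace ((n ^ 3 - n) / (m ^ 3 - m) * (m * (m - 1) ^ 2))
  with (n * (n - 1) * ((n + 1) * (m - 1) / (m + 1))).
2: { field; split; [ | lra].
  replace (m ^ 3 - m) with (m * (m - 1) * (m + 1)) by ring.
  repeat apply Rmult_integral_contrapositive_currified; lra. }
replace (n * (n - 1) ^ 2) with (n * (n - 1) * (n - 1)) by ring.
apply Rmult_lt_compat_l; trivial.
apply Rmult_lt_reg_r with (m + 1); [lra | ].
replace ((n + 1) * (m - 1) / (m + 1) * (m + 1)) with ((n + 1) * (m - 1))
  by (field; lra).
lra.
Qed.

Theorem theorem1 :
  forall m n : nat,
    Nat.Odd m -> Nat.Even n ->
    0.5 <= INR n / INR m <= 0.8194 ->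
    (81 <= m)%nat ->
    (is_min_at (bombieri_f m n) 0 /\
     bombieri_f m n 0 =
       Finite ((INR n ^ 3 - INR n) / (INR m ^ 3 - INR m))) /\
    bombieri_sigma m n <> bombieri_B m n.
Proof.
intros m n hmo hne hq hm81.
assert (hm : 81 <= INR m).
  replace 81 with (INR 81) by (simpl; lra); apply le_INR, hm81.
assert (hnm : 0.5 * INR m <= INR n <= 0.8194 * INR m).
{ replace (INR n) with (INR n / INR m * INR m) by (field; lra).
  split; apply Rmult_le_compat_r; lra. }
pose proof (bombieri_f_0 m n hmo hne hm hnm) as h0.
assert (hmin : is_min_at (bombieri_f m n) 0)
  by (intros x; rewrite h0; apply bombieri_f_ge; trivial).
split; [split; trivial | ].
rewrite (bombieri_B_eq_min m n 0 hmin), h0.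
set (Q := INR m * (INR m - 1) ^ 2); set (c := limit_ratio (INR n) (INR m)).
assert (hQ : 0 < Q) by (apply Rmult_lt_0_compat; [ | apply pow_lt]; lra).
assert (hlt : INR n * (INR n - 1) ^ 2 / Q < c).
{ apply Rmult_lt_reg_r with Q; trivial.
  replace (INR n * (INR n - 1) ^ 2 / Q * Q) with (INR n * (INR n - 1) ^ 2)
    by (field; lra).
  apply rotation_ratio_lt; lra. }
assert (hn1 : (1 <= n)%nat) by (apply INR_le; simpl; lra).
(* [bombieri_sigma_le] turns a strict inequality into a weak one, so it is applied at the midpoint,
   which is still strictly below [c]. *)
set (c' := (INR n * (INR n - 1) ^ 2 / Q + c) / 2).
assert (hsig : Rbar_le (bombieri_sigma m n) c').
{ apply bombieri_sigma_le; trivial; [lia | ]; fold Q.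
  replace (INR n * (INR n - 1) ^ 2) with (INR n * (INR n - 1) ^ 2 / Q * Q)
    at 1 by (field; lra).
  apply Rmult_lt_compat_r; unfold c'; lra. }
intros h; rewrite h in hsig; simpl in hsig; unfold c' in hsig; lra.
Qed.
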